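(* Consider Algorithm 1 (defined in the context) with positive constant stepsize $\epsilon$. Suppose that for every bus $i$ the difference between consecutive update time steps in $T_i$ is upper bounded by $T_a$, and that for all $i$ and $t$ the delay $\tau_i(t)$ is upper bounded by $T_d$. If $$\epsilon<\frac{2}{\sigma_{\max}(X)+2\|X\|_F\,T_d},$$ then $d(v(t))$ converges to $0$, and $v(t)$ converges to a point $v^*\in[\underline{v},\bar{v}]$.
   Context: Network: a tree with bus set $\{0,1,\dots,n\}$ rooted at bus $0$ (the substation), with edge set $E$; each line $(h,k)\in E$ has reactance $x_{hk}>0$. Let $\mathcal{P}_i\subset E$ be the set of lines on the unique path from bus $0$ to bus $i$. The matrix $X\in\mathbb{R}^{n\times n}$ is $X_{ij}=2\sum_{(h,k)\in\mathcal{P}_i\cap\mathcal{P}_j}x_{hk}$, $1\le i,j\le n$; it is symmetric positive definite. $\sigma_{\max}$ is the largest singular value, $\|\cdot\|_F$ the Frobenius norm. Voltage limits $\underline{v},\bar{v}\in\mathbb{R}^n$ with $\underline{v}_i\le\bar{v}_i$ for all $i$, and $[\underline{v},\bar{v}]=\{v\in\mathbb{R}^n:\underline{v}_i\le v_i\le\bar{v}_i\ \forall i\}$. A fixed arbitrary $v^{par}\in\mathbb{R}^n$ is the operating condition. Voltages $v(t)\in\mathbb{R}^n$ and reactive power injections $q(t)\in\mathbb{R}^n$ satisfy $v(t+1)=Xq(t)+v^{par}$. With $[a]^+=\max(a,0)$, define $d_i(v_i)=[v_i-\bar{v}_i]^+-[\underline{v}_i-v_i]^+$ and $d(v)=(d_1(v_1),\dots,d_n(v_n))^T$.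 Algorithm 1: each bus $i\in\{1,\dots,n\}$ has an infinite set $T_i\subseteq\{1,2,\dots\}$ of update time steps and integer measurement delays $\tau_i(t)\ge 0$ (arbitrary nonnegative integers, without effect on the algorithm, when $t\notin T_i$). At time $t$: - if $t\notin T_i$: $q_i(t)=q_i(t-1)$; - if $t\in T_i$: $q_i(t)=q_i(t-1)-\epsilon\, d_i\big(v_i(t-\tau_i(t))\big)$. *)

(* Defs.v *)
(* MathComp / MathComp-Analysis. *)
From HB Require Import structures.
From mathcomp Require Import all_boot all_order all_algebra.
From mathcomp Require Import all_classical all_reals all_analysis.

Set Implicit Arguments.
Unset Strict Implicit.
Unset Printing Implicit Defensive.

Import Order.TTheory GRing.Theory Num.Theory.
Import numFieldNormedType.Exports.

Local Open Scope classical_set_scope.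
Local Open Scope ring_scope.

(* A network on the buses 0, ..., n is given by its set of lines, each line
   being an unordered pair of distinct buses. *)
Definition adj n (E : {set {set 'I_n.+1}}) : rel 'I_n.+1 :=
  fun h k => [set h; k]%SET \in E.

(* Connected and without cycle; a closed walk h, k, h along a single line is a
   [ucycle] of size 2, so only sizes at least 3 are excluded. *)
Definition is_tree n (E : {set {set 'I_n.+1}}) : Prop :=
  [/\ forall l, l \in E -> #|l| = 2%N,
      forall h k : 'I_n.+1, connect (adj E) h k
    & forall c : seq 'I_n.+1, ucycle (adj E) c -> (size c <= 2)%N].

Definition walk_lines n (h : 'I_n.+1) (p : seq 'I_n.+1) :
    {set {set 'I_n.+1}} :=
  [set [set u.1; u.2]%SET | u in zip (h :: p) p]%SET.

(* In a tree the simple path p below exists and is unique. *)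
Definition root_lines n (E : {set {set 'I_n.+1}}) (i : 'I_n.+1) :
    {set {set 'I_n.+1}} :=
  [set l | `[< exists p : seq 'I_n.+1,
               [/\ path (adj E) ord0 p, uniq (ord0 :: p), last ord0 p = i
                 & l \in walk_lines ord0 p] >]]%SET.

(* Rows and columns are indexed by the buses other than the substation:
   index i : 'I_n stands for the bus [lift ord0 i], of value i.+1. *)
Definition Xmat (R : realType) n (E : {set {set 'I_n.+1}})
    (x : {set 'I_n.+1} -> R) : 'M[R]_n :=
  \matrix_(i < n, j < n)
    (2 * \sum_(l in (root_lines E (lift ord0 i)
                      :&: root_lines E (lift ord0 j))%SET) x l).

Definition singular_values (R : realType) m n (A : 'M[R]_(m, n)) : set R :=
  [set s : R | 0 <= s /\ eigenvalue (A^T *m A) (s ^+ 2)].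

(* For n > 0 the set is finite and nonempty, so [sup] is its maximum. *)
Definition sigma_max (R : realType) m n (A : 'M[R]_(m, n)) : R :=
  sup (singular_values A).

Definition frobenius (R : realType) m n (A : 'M[R]_(m, n)) : R :=
  Num.sqrt (\sum_i \sum_j A i j ^+ 2).

Definition pos_part (R : realType) (a : R) : R := Num.max a 0.

Definition box (R : realType) n (vlow vbar : 'cV[R]_n) : set 'cV[R]_n :=
  [set v | forall i, vlow i ord0 <= v i ord0 <= vbar i ord0].

Definition dcoord (R : realType) n (vlow vbar : 'cV[R]_n) (i : 'I_n) (a : R) : R :=
  pos_part (a - vbar i ord0) - pos_part (vlow i ord0 - a).

Definition dvec (R : realType) n (vlow vbar v : 'cV[R]_n) : 'cV[R]_n :=
  \col_i dcoord vlow vbar i (v i ord0).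

Definition consecutive_in (T : set nat) (s t : nat) : Prop :=
  [/\ T s, T t, (s < t)%N & forall r, T r -> ~~ (s < r < t)%N].

(* Time starts at 0. A delay may reach back before the start, so v is indexed
   by the integers; v(t) for t <= 0 is an arbitrary history and only v(t) for
   t >= 1 obeys this relation. *)
Definition voltage_dynamics (R : realType) n (X : 'M[R]_n) (vpar : 'cV[R]_n)
    (q : nat -> 'cV[R]_n) (v : int -> 'cV[R]_n) : Prop :=
  forall t : nat, v t.+1%:Z = X *m q t + vpar.

Definition async_update (R : realType) n (eps : R) (vlow vbar : 'cV[R]_n)
    (T : 'I_n -> set nat) (tau : 'I_n -> nat -> nat)
    (q : nat -> 'cV[R]_n) (v : int -> 'cV[R]_n) : Prop :=
  forall (i : 'I_n) (t : nat), (0 < t)%N ->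
    (~ T i t -> q t i ord0 = q t.-1 i ord0) /\
    (T i t -> q t i ord0 = q t.-1 i ord0
       - eps * dcoord vlow vbar i (v (t%:Z - (tau i t)%:Z) i ord0)).

(* Main.v *)
(* Measure the distance to a point [c] of injections with [X c + vpar] in the
   box by the energy [(q - c) . X (q - c)]. An update with fresh measurements
   lowers it, because [d] points away from the box; stale measurements cost at
   most [|X|_F] times products of recent step lengths. The step size bound lets
   a weighted sum of the last [Td] squared steps absorb this cost, so energy
   plus that sum decreases, the steps tend to 0, and every such energy
   converges. As each bus updates within bounded windows, [d(v) --> 0].
   The energies of two reference points whose voltages differ only at bus [i]
   differ by an affine function of [q_i], so [q_i] converges at buses with
   [vlow_i < vbar_i]; at the others [v_i] converges since [d_i] does. Positive
   definiteness of [X] turns this mixed information into convergence of [q]. *)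

Require Import Defs.
From HB Require Import structures.
From mathcomp Require Import all_boot all_order all_algebra.
From mathcomp Require Import all_classical all_reals all_analysis.
From mathcomp Require Import ring lra zify.

Set Implicit Arguments.
Unset Strict Implicit.
Unset Printing Implicit Defensive.

Import Order.TTheory GRing.Theory Num.Theory.
Import numFieldNormedType.Exports.

Local Open Scope classical_set_scope.
Local Open Scope ring_scope.

(** * Quadratic forms, the Frobenius norm and the largest singular value *)

Section LinearAlgebra.
Variable R : realType.

Definition dotc n (u w : 'cV[R]_n) : R := \sum_i u i ord0 * w i ord0.

Lemma dotcC n (u w : 'cV[R]_n) : dotc u w = dotc w u.
Proof. by apply: eq_bigr => i _; rewrite mulrC. Qed.

Lemma dotcDl n (u1 u2 w : 'cV[R]_n) : dotc (u1 + u2) w = dotc u1 w + dotc u2 w.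
Proof. by rewrite -big_split; apply: eq_bigr => i _; rewrite mxE mulrDl. Qed.

Lemma dotcDr n (u w1 w2 : 'cV[R]_n) : dotc u (w1 + w2) = dotc u w1 + dotc u w2.
Proof. by rewrite dotcC dotcDl !(dotcC _ u). Qed.

Lemma dotcZl n a (u w : 'cV[R]_n) : dotc (a *: u) w = a * dotc u w.
Proof. by rewrite mulr_sumr; apply: eq_bigr => i _; rewrite mxE mulrA. Qed.

Lemma dotcZr n a (u w : 'cV[R]_n) : dotc u (a *: w) = a * dotc u w.
Proof. by rewrite dotcC dotcZl dotcC. Qed.

Lemma dotcNl n (u w : 'cV[R]_n) : dotc (- u) w = - dotc u w.
Proof. by rewrite -scaleN1r dotcZl mulN1r. Qed.

Lemma dotcNr n (u w : 'cV[R]_n) : dotc u (- w) = - dotc u w.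
Proof. by rewrite -scaleN1r dotcZr mulN1r. Qed.

Definition dotcE := (dotcDl, dotcDr, dotcZl, dotcZr, dotcNl, dotcNr).

Lemma dotc_ge0 n (u : 'cV[R]_n) : 0 <= dotc u u.
Proof. by apply: sumr_ge0 => i _; rewrite -expr2 sqr_ge0. Qed.

Lemma dotc_eq0 n (u : 'cV[R]_n) : dotc u u = 0 -> u = 0.
Proof.
move=> /eqP; rewrite psumr_eq0; last by move=> i _; rewrite -expr2 sqr_ge0.
move=> /allP u0; apply/matrixP => i j; rewrite ord1 mxE.
by have := u0 i (mem_index_enum i); rewrite mulf_eq0 orbb => /eqP.
Qed.

Lemma dotc_mulmx m n (A : 'M[R]_(m, n)) u w :
  dotc u (A *m w) = dotc (A^T *m u) w.
Proof.
rewrite /dotc; under eq_bigr do rewrite mxE mulr_sumr.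
rewrite exchange_big; apply: eq_bigr => j _; rewrite mxE mulr_suml.
by apply: eq_bigr => i _; rewrite mxE mulrA [_ * A i j]mulrC.
Qed.

Lemma dotc_delta n (u : 'cV[R]_n) i : dotc u (delta_mx i ord0) = u i ord0.
Proof.
rewrite /dotc (bigD1 i) //= big1 ?addr0 => [|j /negPf ji]; rewrite mxE.
  by rewrite !eqxx mulr1.
by rewrite ji mulr0.
Qed.

Definition psd n (A : 'M[R]_n) :=
  A^T = A /\ forall u : 'cV[R]_n, 0 <= dotc u (A *m u).

Lemma discriminant_le (a b c : R) :
  (forall t, 0 <= a + 2 * b * t + c * t ^+ 2) -> b ^+ 2 <= a * c.
Proof.
move=> H; have a0 : 0 <= a by have := H 0; nra.
have [c0|cN0] := eqVneq c 0.
  have [->|bN0] := eqVneq b 0; first by rewrite c0; nra.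
  have := H (- (a + 1) / (2 * b)); rewrite c0.
  have -> : a + 2 * b * (- (a + 1) / (2 * b)) +
            0 * (- (a + 1) / (2 * b)) ^+ 2 = -1 by field.
  lra.
have : 0 <= c.
  have [//|c_lt0] := leP 0 c.
  (* At this [t >= 1] the quadratic term outweighs the others: the value is at most [c * t < 0]. *)
  have := H (1 + (`|a| + 2 * `|b|) / - c).
  set t := 1 + _; have t1 : 1 <= t.
    by rewrite lerDl divr_ge0 ?addr_ge0 ?mulr_ge0 ?oppr_ge0 // ltW.
  have ct : c * t = c - (`|a| + 2 * `|b|) by rewrite /t; field.
  have := ler_norm a; have := ler_norm b; have := normr_ge0 a.
  by have := normr_ge0 b; rewrite expr2 mulrA ct; nra.
move=> c_ge0; have c_gt0 : 0 < c by rewrite lt_def cN0.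
have := H (- b / c).
have -> : a + 2 * b * (- b / c) + c * (- b / c) ^+ 2 = (a * c - b ^+ 2) / c.
  by field.
by rewrite pmulr_lge0 ?invr_gt0 // subr_ge0.
Qed.

Lemma psd_cauchy n (A : 'M[R]_n) u w : psd A ->
  dotc u (A *m w) ^+ 2 <= dotc u (A *m u) * dotc w (A *m w).
Proof.
move=> [Asym Age0]; apply: discriminant_le => t.
have := Age0 (u + t *: w); rewrite mulmxDr -scalemxAr !dotcE.
have -> : dotc w (A *m u) = dotc u (A *m w) by rewrite dotc_mulmx Asym dotcC.
by congr (_ <= _); ring.
Qed.

Lemma dotc_cauchy n (u w : 'cV[R]_n) : dotc u w ^+ 2 <= dotc u u * dotc w w.
Proof.
have /psd_cauchy : psd (1%:M : 'M[R]_n).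
  by split=> [|z]; rewrite ?trmx1 // mul1mx dotc_ge0.
by move=> /(_ u w); rewrite !mul1mx.
Qed.

Lemma frobenius_ge0 m n (A : 'M[R]_(m, n)) : 0 <= frobenius A.
Proof. exact: sqrtr_ge0. Qed.

Lemma frobeniusP m n (A : 'M[R]_(m, n)) (u : 'cV[R]_n) :
  dotc (A *m u) (A *m u) <= frobenius A ^+ 2 * dotc u u.
Proof.
rewrite sqr_sqrtr; last by do 2![apply: sumr_ge0 => ? _]; rewrite sqr_ge0.
rewrite mulr_suml; apply: ler_sum => i _.
have -> : (A *m u) i ord0 = dotc (row i A)^T u.
  by rewrite mxE; apply: eq_bigr => j _; rewrite !mxE.
rewrite -expr2 (le_trans (dotc_cauchy _ _)) // ler_wpM2r ?dotc_ge0 //.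
by apply: ler_sum => j _; rewrite !mxE expr2.
Qed.

(** Bounds the cost of stale measurements. Absolute values stay inside the sum because each bus has
    its own delay; Cauchy-Schwarz, [frobeniusP] and the arithmetic-geometric mean inequality give
    the bound. *)
Lemma sum_norm_mulmx_le m n (A : 'M[R]_(m, n)) (u : 'cV[R]_m) (w : 'cV[R]_n) :
  \sum_i `|u i ord0| * `|(A *m w) i ord0| <=
  frobenius A * (dotc u u + dotc w w) / 2.
Proof.
pose au : 'cV[R]_m := map_mx Num.norm u.
pose aw : 'cV[R]_m := map_mx Num.norm (A *m w).
have -> : \sum_i `|u i ord0| * `|(A *m w) i ord0| = dotc au aw.
  by apply: eq_bigr => i _; rewrite !mxE.
have norm2 k (z : 'cV[R]_k) : dotc (map_mx Num.norm z) (map_mx Num.norm z) = dotc z z.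
  by apply: eq_bigr => i _; rewrite !mxE -normrM ger0_norm // -expr2 sqr_ge0.
have F0 := frobenius_ge0 A; have u0 := dotc_ge0 u; have w0 := dotc_ge0 w.
rewrite -[leLHS]ger0_norm; last first.
  by apply: sumr_ge0 => i _; rewrite !mxE mulr_ge0.
rewrite -ler_sqr ?nnegrE ?normr_ge0 //; last by rewrite divr_ge0 // mulr_ge0 ?addr_ge0.
rewrite real_normK ?num_real //.
apply: le_trans (dotc_cauchy _ _) _; rewrite !norm2.
apply: le_trans (ler_wpM2l u0 (frobeniusP _ _)) _.
have -> : (frobenius A * (dotc u u + dotc w w) / 2) ^+ 2 =
  dotc u u * (frobenius A ^+ 2 * dotc w w) +
  (frobenius A * (dotc u u - dotc w w) / 2) ^+ 2 by field.
by rewrite lerDl sqr_ge0.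
Qed.

Lemma dotc_le_frobenius n (A : 'M[R]_n) u :
  dotc u (A *m u) <= frobenius A * dotc u u.
Proof.
have := sum_norm_mulmx_le A u u.
have -> : frobenius A * (dotc u u + dotc u u) / 2 = frobenius A * dotc u u.
  by field.
apply: le_trans; apply: ler_sum => i _.
by rewrite -normrM ler_norm.
Qed.

Lemma unitmx_inj n (A : 'M[R]_n) :
  (forall u : 'cV[R]_n, A *m u = 0 -> u = 0) -> A \in unitmx.
Proof.
move=> A0; rewrite -unitmx_tr -row_free_unit -kermx_eq0; apply/eqP/row_matrixP => i.
rewrite row0; apply: trmx_inj; rewrite trmx0; apply: A0.
by rewrite -[X in X *m _]trmxK -trmx_mul -row_mul mulmx_ker row0 trmx0.
Qed.

Lemma nunitmx_ker n (A : 'M[R]_n) : A \notin unitmx ->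
  exists2 u : 'cV[R]_n, A *m u = 0 & u != 0.
Proof.
move=> /negP nA; apply: contrapT => nex; apply: nA.
apply: unitmx_inj => u Au; apply/eqP; apply: contrapT => /negP u0.
by apply: nex; exists u.
Qed.

(* With [w := A u], Cauchy-Schwarz for the form [A] gives
   [|w|^4 <= (u . A u) (w . A w) <= (u . A u) |A|_F |w|^2]. *)
Lemma psd_coercive n (A : 'M[R]_n) : psd A -> A \in unitmx ->
  exists2 c : R, 0 < c & forall u, c * dotc u u <= dotc u (A *m u).
Proof.
move=> psdA unitA; have [Asym Age0] := psdA.
(* [K] comes from [u = invmx A *m w] and [frobeniusP]; using [1 + K] avoids inverting 0 in dimension
   0. *)
pose K := frobenius (invmx A) ^+ 2 * frobenius A.
have K0 : 0 <= K by rewrite mulr_ge0 ?sqr_ge0 ?frobenius_ge0.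
exists (1 + K)^-1; first by rewrite invr_gt0; lra.
move=> u; rewrite ler_pdivrMl; last by lra.
have uA0 := Age0 u; set w := A *m u.
have ww : dotc w w <= frobenius A * dotc u w.
  have [->|w0] := eqVneq (dotc w w) 0; first by rewrite mulr_ge0 ?frobenius_ge0.
  have wgt0 : 0 < dotc w w by rewrite lt_def w0 dotc_ge0.
  have := psd_cauchy u w psdA; rewrite dotc_mulmx Asym -/w expr2 => cs.
  have := ler_wpM2l uA0 (dotc_le_frobenius A w).
  by move=> /(le_trans cs); rewrite mulrA ler_pM2r // mulrC.
have := frobeniusP (invmx A) w; rewrite mulKmx // => uu.
apply: le_trans uu _; rewrite -/w in uA0 *.
apply: le_trans (ler_wpM2l _ ww) _; first exact: sqr_ge0.
by rewrite mulrA -/K; nra.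
Qed.

Lemma sigma_max_ub m n (A : 'M[R]_(m, n)) s :
  singular_values A s -> s <= sigma_max A.
Proof.
move=> As; apply: ub_le_sup => //; exists (frobenius A) => r [r0].
move=> /eigenvalueP[z zA z0].
have zz : 0 < dotc z^T z^T.
  rewrite lt_def dotc_ge0 andbT; apply: contra_neqN z0 => /eqP /dotc_eq0 z0.
  by apply: trmx_inj; rewrite z0 trmx0.
have := frobeniusP A z^T; rewrite dotc_mulmx mulmxA.
have -> : A^T *m A *m z^T = r ^+ 2 *: z^T.
  by rewrite -linearZ /= -zA trmx_mul trmx_mul trmxK.
by rewrite dotcZl ler_pM2r // ler_sqr ?nnegrE ?frobenius_ge0.
Qed.

Lemma sigma_max_ge0 m n (A : 'M[R]_(m, n)) : 0 <= sigma_max A.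
Proof.
have [[s As]|A0] := pselect (exists s, singular_values A s).
  by apply: le_trans (sigma_max_ub As); case: As.
(* Without singular values, as in dimension 0, [sup] is 0 by default. *)
rewrite /sigma_max; suff -> : singular_values A = set0 by rewrite sup0.
by apply/seteqP; split=> // s As; case: A0; exists s.
Qed.

(* The supremum [lambda] of the Rayleigh quotient is positive only if it is an
   eigenvalue: otherwise [lambda - A] would be coercive. *)
Lemma dotc_le_sigma_max n (A : 'M[R]_n) u : psd A ->
  dotc u (A *m u) <= sigma_max A * dotc u u.
Proof.
move=> [Asym Age0].
(* The unit ball rather than the sphere, so that [S] contains 0 even in dimension 0. *)
pose S := [set r | exists2 z : 'cV[R]_n, dotc z z <= 1 & r = dotc z (A *m z)].
have S0 : S 0 by exists 0; rewrite /dotc big1 // => i _; rewrite mxE mul0r.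
have Sub : has_ubound S.
  exists (frobenius A) => _ [z z1 ->]; apply: le_trans (dotc_le_frobenius _ _) _.
  by rewrite ler_piMr ?frobenius_ge0.
set lambda := sup S.
have l0 : 0 <= lambda by exact: ub_le_sup.
have rayleigh z : dotc z (A *m z) <= lambda * dotc z z.
  have [z0|z0] := eqVneq (dotc z z) 0.
    by rewrite z0 (dotc_eq0 z0) mulmx0 mulr0 /dotc big1 // => i _; rewrite mxE mul0r.
  have zz : 0 < dotc z z by rewrite lt_def z0 dotc_ge0.
  rewrite -ler_pdivrMr //; apply: ub_le_sup => //.
  pose a := (Num.sqrt (dotc z z))^-1.
  have aa : a * a = (dotc z z)^-1.
    by rewrite /a -invfM -expr2 sqr_sqrtr ?dotc_ge0.
  exists (a *: z); rewrite -?scalemxAr !dotcE mulrA aa ?mulVf //.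
  by rewrite mulrC.
apply: le_trans (rayleigh u) _; rewrite ler_wpM2r ?dotc_ge0 //.
pose B := lambda%:M - A.
have BE z : B *m z = lambda *: z - A *m z by rewrite mulmxBl mul_scalar_mx.
have psdB : psd B.
  split=> [|z]; first by rewrite linearB /= tr_scalar_mx Asym.
  by rewrite BE !dotcE subr_ge0.
have [unitB|] := boolP (B \in unitmx).
  have [c c0 Bc] := psd_coercive psdB unitB.
  apply: le_trans (sigma_max_ge0 A).
  (* Coercivity bounds the form by [(lambda - c) * dotc z z]; on the ball this is at most the
     maximum with 0, which forces [lambda <= 0]. *)
  have : lambda <= Num.max (lambda - c) 0.
    apply: ge_sup; first by exists 0.
    move=> _ [z z1 ->]; have := Bc z; rewrite BE !dotcE.
    have := dotc_ge0 z; rewrite le_max; case: (leP c lambda) => lc z0 zc.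
      by apply/orP; left; nra.
    by apply/orP; right; nra.
  by rewrite le_max => /orP[|//]; lra.
move=> /nunitmx_ker[z]; rewrite BE => /eqP; rewrite subr_eq0 => /eqP zA z0.
apply: sigma_max_ub; split=> //; apply/eigenvalueP; exists z^T; last first.
  by apply: contra_neq z0 => /(congr1 trmx); rewrite trmxK trmx0.
apply: trmx_inj; rewrite !trmx_mul trmxK linearZ /= trmxK Asym -mulmxA.
by rewrite -zA -scalemxAr -zA scalerA.
Qed.

End LinearAlgebra.

(** * Simple paths from the root of a tree *)

Section Tree.
Variables (n : nat) (E : {set {set 'I_n.+1}}).

Lemma adj_sym : symmetric (adj E).
Proof. by move=> h k; rewrite /adj finset.setUC. Qed.

(* Two simple paths that separate at [u] and meet again close up to a cycle
   through [u] of length at least 3. *)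
Lemma simple_path_unique u (p p' : seq 'I_n.+1) : is_tree E ->
  path (adj E) u p -> uniq (u :: p) ->
  path (adj E) u p' -> uniq (u :: p') -> last u p = last u p' -> p = p'.
Proof.
move=> treeE; elim: p u p' => [|a p IH] u [|b p'] //.
- by move=> _ _ _ /= /andP[/negP up' _] eq_u; case: up'; rewrite eq_u mem_last.
- by move=> _ /= /andP[/negP up _] _ _ eq_u; case: up; rewrite -eq_u mem_last.
have [<-|ab] := eqVneq a b.
  move=> /= /andP[_ pp] /andP[_ up] /andP[_ pp'] /andP[_ up'] eq_l.
  by congr cons; apply: IH pp up pp' up' eq_l.
move=> /= /andP[ua pp] /andP[unp _] /andP[ub pp'] /andP[unp' _] eq_l.
(* Along [p'] from [b] to the common end, then back along [p] to [a]: a walk that avoids [u], to be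
   shortened to a simple path. *)
have pathba : path (adj E) b (p' ++ rev (belast a p)).
  rewrite cat_path pp' -eq_l rev_path /=.
  by rewrite (eq_path (e' := adj E)) // => h k; rewrite adj_sym.
have last_ba : last b (p' ++ rev (belast a p)) = a.
  rewrite last_cat -eq_l; case: p {IH pp unp eq_l pathba} => //= c p.
  by rewrite rev_cons last_rcons.
have u_ba : u \notin b :: p' ++ rev (belast a p).
  rewrite -cat_cons mem_cat negb_or unp' mem_rev.
  by apply: contra unp => /mem_belast.
case/shortenP: pathba last_ba u_ba => r pr ur sub_r last_r u_ba.
have u_r : u \notin b :: r.
  apply: contra u_ba; rewrite !inE => /orP[->//|/sub_r ->].
  by rewrite orbT.
have cyc : ucycle (adj E) (u :: b :: r).
  apply/andP; split; last by rewrite cons_uniq u_r.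
  by rewrite /= rcons_path ub pr last_r adj_sym ua.
case: treeE => _ _ /(_ _ cyc).
by case: r last_r {pr ur sub_r u_r cyc} => [/= ba|//]; rewrite ba eqxx in ab.
Qed.

Definition root_path i (p : seq 'I_n.+1) :=
  [/\ path (adj E) ord0 p, uniq (ord0 :: p) & last ord0 p = i].

Lemma root_path_ex i : is_tree E -> exists p, root_path i p.
Proof.
case=> _ /(_ ord0 i) /connectP[p pp ->] _.
by case/shortenP: pp => p' pp' up' _; exists p'.
Qed.

Lemma root_path_unique i p p' :
  is_tree E -> root_path i p -> root_path i p' -> p = p'.
Proof.
move=> treeE [pp up lp] [pp' up' lp'].
by apply: simple_path_unique pp up pp' up' _ => //; rewrite lp lp'.
Qed.

Lemma root_linesP i p l : is_tree E -> root_path i p ->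
  (l \in root_lines E i) = (l \in walk_lines ord0 p).
Proof.
move=> treeE pi; rewrite inE; apply/asboolP/idP => [[p' [pp' up' lp' lin]]|lin].
  by rewrite (root_path_unique treeE pi (And3 pp' up' lp')).
by case: pi => ? ? ?; exists p.
Qed.

Lemma walk_linesP (h : 'I_n.+1) p l : reflect
  (exists p1 a p2, p = p1 ++ a :: p2 /\ l = [set last h p1; a]%SET)
  (l \in walk_lines h p).
Proof.
apply: (iffP imsetP) => [[[a b] /= abp ->]|[p1 [a [p2 [-> ->]]]]].
  elim: p h abp => [//|c p IH] h; rewrite /= inE => /orP[/eqP[-> ->]|abp].
    by exists [::], c, p.
  by have [p1 [a' [p2 [-> ->]]]] := IH c abp; exists (c :: p1), a', p2.
exists (last h p1, a) => //; elim: p1 h => [|c p1 IH] h /=.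
  by rewrite inE eqxx.
by rewrite inE IH orbT.
Qed.

Lemma walk_lines_sub h p l : path (adj E) h p -> l \in walk_lines h p -> l \in E.
Proof.
move=> pp /walk_linesP[p1 [a [p2 [pE ->]]]].
by move: pp; rewrite pE cat_path => /andP[_ /andP[]].
Qed.

(* A simple path from the root through the last line of the path to [i] must
   traverse it downwards, hence runs through [i]. *)
Lemma last_line_root i p a j p' : is_tree E ->
  root_path i (rcons p a) -> root_path j p' ->
  [set last ord0 p; a]%SET \in walk_lines ord0 p' ->
  j = i \/ (size (rcons p a) < size p')%N.
Proof.
move=> treeE pi pj /walk_linesP[p1 [b [p2 [p'E eq_l]]]].
have ai : a = i by case: pi => _ _; rewrite last_rcons.
have [pp' up' lp'] := pj.
have simple_prefix p3 p4 : p' = p3 ++ p4 -> root_path (last ord0 p3) p3.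
  move=> eq_p'; move: pp' up'; rewrite eq_p' cat_path -cat_cons cat_uniq.
  by move=> /andP[? _] /andP[? _]; split.
have [bi|bNi] := eqVneq b i.
  have p1b := simple_prefix (rcons p1 b) p2.
  rewrite cat_rcons last_rcons bi in p1b.
  have := root_path_unique treeE pi (p1b _); rewrite p'E bi => /(_ erefl) ->.
  case: p2 p'E {p1b} => [|c p2] p'E; last first.
    by right; rewrite size_cat size_rcons /= !addnS ltnS leq_addr.
  by left; rewrite -lp' p'E last_cat /= bi.
(* Upward traversal: [p1] is then the path to [i] and has already visited [b], so [p'] would not be
   simple. *)
have lasti : last ord0 p1 = i.
  have : i \in [set last ord0 p1; b]%SET by rewrite -eq_l -ai !inE eqxx orbT.
  by rewrite !inE eq_sym => /orP[/eqP//|/eqP ib]; rewrite ib eqxx in bNi.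
have := root_path_unique treeE pi; rewrite -lasti => /(_ _ (simple_prefix _ _ p'E)) p1E.
have : b \in [set last ord0 p; a]%SET by rewrite eq_l !inE eqxx orbT.
rewrite !inE ai (negPf bNi) orbF => /eqP bE.
move: up'; rewrite p'E -cat_cons cat_uniq => /and3P[_ /hasPn/(_ b)].
by rewrite inE eqxx -p1E -rcons_cons mem_rcons bE inE mem_last orbT => /(_ isT).
Qed.

End Tree.

(** * Positive definiteness of the reactance matrix *)

Section NetworkMatrix.
Variables (R : realType) (n : nat) (E : {set {set 'I_n.+1}}).
Variable x : {set 'I_n.+1} -> R.
Hypothesis treeE : is_tree E.
Hypothesis x_gt0 : forall l, l \in E -> 0 < x l.

(* The total injection downstream of the line [l]. *)
Definition line_flow (u : 'cV[R]_n) l :=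
  \sum_(i | l \in root_lines E (lift ord0 i)) u i ord0.

Lemma root_lines_sub i l : l \in root_lines E i -> l \in E.
Proof.
by rewrite inE => /asboolP[p [pp _ _]]; apply: walk_lines_sub.
Qed.

(** Membership in both root paths is a product of two indicators, so after exchanging sums each line
    contributes the square of its flow. *)
Lemma Xmat_form u :
  dotc u (Xmat E x *m u) = 2 * \sum_(l in E) x l * line_flow u l ^+ 2.
Proof.
transitivity (\sum_i \sum_j \sum_(l in E)
  2 * x l * (if l \in root_lines E (lift ord0 i) then u i ord0 else 0)
          * (if l \in root_lines E (lift ord0 j) then u j ord0 else 0)).
  apply: eq_bigr => i _; rewrite mxE mulr_sumr; apply: eq_bigr => j _.
  rewrite mxE mulr_sumr !mulr_suml mulr_sumr [RHS]big_mkcond [LHS]big_mkcond /=.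
  apply: eq_bigr => l _; rewrite finset.in_setI.
  case: (boolP (l \in root_lines E (lift ord0 i))) => [lE|_] /=; last first.
    by case: ifP => // _; rewrite mulr0 mul0r.
  rewrite (root_lines_sub lE); case: ifP => _; last by rewrite mulr0.
  by ring.
under eq_bigr do rewrite exchange_big /=.
rewrite exchange_big mulr_sumr; apply: eq_bigr => l _ /=.
have -> : line_flow u l =
    \sum_i (if l \in root_lines E (lift ord0 i) then u i ord0 else 0).
  by rewrite /line_flow big_mkcond.
rewrite expr2 !mulrA [RHS]mulr_sumr exchange_big; apply: eq_bigr => j _ /=.
by rewrite -mulr_suml -mulr_sumr.
Qed.

Lemma Xmat_sym : (Xmat E x)^T = Xmat E x.
Proof. by apply/matrixP => i j; rewrite !mxE finset.setIC. Qed.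

Lemma Xmat_psd : psd (Xmat E x).
Proof.
split=> [|u]; first exact: Xmat_sym.
rewrite Xmat_form mulr_ge0 //; apply: sumr_ge0 => l lE.
by rewrite mulr_ge0 ?sqr_ge0 // ltW ?x_gt0.
Qed.

(* Induction from the deepest buses upwards: apart from [i] itself, only buses
   strictly deeper than [i] draw on the last line of the path to [i]. *)
Lemma line_flow_eq0 u : (forall l, l \in E -> line_flow u l = 0) -> u = 0.
Proof.
move=> flow0.
have /choice[pth pthP] : forall i : 'I_n, exists p, root_path E (lift ord0 i) p.
  by move=> i; apply: root_path_ex.
(* Here [m] bounds the shortfall of the depth of [i] from [n.+1]; a simple path on [n.+1] buses has
   at most [n] lines, which settles [m = 0]. *)
suff H m i : (n.+1 <= size (pth i) + m)%N -> u i ord0 = 0.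
  by apply/matrixP => i j; rewrite ord1 mxE; apply: (H n.+1); rewrite leq_addl.
elim: m i => [|m IH] i lem.
  have [_ up _] := pthP i; have := card_uniqP up => /= cardp.
  have := max_card [in ord0 :: pth i]; rewrite card_ord /= => /leq_trans.
  by move=> /(_ _ lem); rewrite addn0 cardp ltnn.
have := pthP i; case/lastP: (pth i) lem => [|p a] lem pi.
  by case: pi => _ _ /= /eqP; rewrite -(inj_eq val_inj).
have l_i : [set last ord0 p; a]%SET \in root_lines E (lift ord0 i).
  rewrite (root_linesP _ treeE pi); apply/walk_linesP; exists p, a, [::].
  by rewrite cats1.
have := flow0 _ (root_lines_sub l_i).
rewrite /line_flow (bigD1 i) //= big1 ?addr0 // => j /andP[l_j ji].
rewrite (root_linesP _ treeE (pthP j)) in l_j.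
have [/lift_inj jE|size_lt] := last_line_root treeE pi (pthP j) l_j.
  by rewrite jE eqxx in ji.
by apply: IH; lia.
Qed.

Lemma Xmat_definite u : dotc u (Xmat E x *m u) = 0 -> u = 0.
Proof.
rewrite Xmat_form => /eqP; rewrite mulf_eq0 pnatr_eq0 /= => /eqP H.
apply: line_flow_eq0 => l lE.
have pos k : k \in E -> 0 <= x k * line_flow u k ^+ 2.
  by move=> kE; rewrite mulr_ge0 ?sqr_ge0 // ltW ?x_gt0.
have := psumr_eq0P pos H lE => /eqP; rewrite mulf_eq0 sqrf_eq0.
by rewrite gt_eqF ?x_gt0 //= => /eqP.
Qed.

End NetworkMatrix.

(** * Convergent sequences, sliding windows and update times *)

Section Sequences.
Variable R : realType.
Local Notation "u ~~> l" := (u @ \oo --> (l : R)) (at level 70).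

Lemma cvg_sum_seq (I : Type) (r : seq I) (f : I -> nat -> R) (l : I -> R) :
  (forall i, f i ~~> l i) -> (fun t => \sum_(i <- r) f i t) ~~> \sum_(i <- r) l i.
Proof.
move=> fl; elim: r => [|i r IH].
  by under eq_fun do rewrite big_nil; rewrite big_nil; exact: cvg_cst.
by under eq_fun do rewrite big_cons; rewrite big_cons; exact: cvgD (fl i) IH.
Qed.

Lemma cvg_window0 (g : nat -> R) (w : nat -> R) L :
  g ~~> 0 -> (fun t => \sum_(k < L) w k * g (t + k)%N) ~~> 0.
Proof.
move=> g0.
have z : \sum_(k < L) w k * 0 = 0 by apply: big1 => k _; rewrite mulr0.
rewrite -[X in _ --> X]z.
apply: (@cvg_sum_seq _ _ (fun (k : 'I_L) t => w k * g (t + k)%N)) => k.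
apply: cvgM; first exact: cvg_cst.
by rewrite (cvg_shiftn k g).
Qed.

Lemma cvg_coord m n (f : nat -> 'M[R]_(m, n)) (M : 'M[R]_(m, n)) :
  (forall i j, (fun t => f t i j) ~~> M i j) -> f @ \oo --> M.
Proof.
move=> fM; apply/cvg_mx_entourageP => A entA.
have H i j : \forall t \near \oo, A (M i j, f t i j).
  by have /cvg_entourageP := fM i j; apply.
have : \forall t \near \oo, forall i j, A (M i j, f t i j).
  by apply: filter_forall => i; apply: filter_forall => j; exact: H.
by apply: filterS => t Ht i j; rewrite inE.
Qed.

Lemma cvg_mulmx_coord m n (A : 'M[R]_(m, n)) (f : nat -> 'cV[R]_n) (l : 'cV[R]_n) i :
  (forall j, (fun t => f t j ord0) ~~> l j ord0) ->
  (fun t => (A *m f t) i ord0) ~~> (A *m l) i ord0.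
Proof.
move=> fl; rewrite mxE; under eq_fun do rewrite mxE.
apply: (@cvg_sum_seq _ _ (fun j t => A i j * f t j ord0)) => j.
by apply: cvgM (fl j); exact: cvg_cst.
Qed.

Lemma cvg0_sqr_le (f g : nat -> R) :
  (forall t, f t ^+ 2 <= g t) -> g ~~> 0 -> f ~~> 0.
Proof.
move=> fg /cvgr0Pnorm_lt g0; apply/cvgr0Pnorm_lt => e e0.
have := g0 _ (exprn_gt0 2 e0); apply: filterS => t gt.
have ft2 : f t ^+ 2 < e ^+ 2.
  by apply: le_lt_trans (fg t) _; apply: le_lt_trans (ler_norm _) gt.
by rewrite ltr_norml; apply/andP; split; nra.
Qed.

(** Telescoping between [a] and [b], then enlarging to the whole window, gives one bound that serves
    every delay. *)
Lemma window_dist (y : nat -> R) t L a b :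
  (t <= a <= t + L)%N -> (t <= b <= t + L)%N ->
  `|y a - y b| <= \sum_(k < L) `|y (t + k).+1 - y (t + k)%N|.
Proof.
wlog ab : a b / (a <= b)%N => [H|] aL bL.
  by case: (leqP a b) => [|/ltnW] ab; [|rewrite distrC]; apply: H.
have -> : \sum_(k < L) `|y (t + k).+1 - y (t + k)%N| =
    \sum_(t <= k < t + L) `|y k.+1 - y k|.
  rewrite -[X in \sum_(X <= _ < _) _]add0n big_addn addKn big_mkord.
  by apply: eq_bigr => k _; rewrite addnC.
case/andP: aL bL => ta _ /andP[_ bL].
rewrite distrC -(telescope_sumr _ ab); apply: le_trans (ler_norm_sum _ _ _) _.
rewrite (big_cat_nat ta (leq_trans ab bL)) /= (big_cat_nat ab bL) /=.
by rewrite addrCA lerDl addr_ge0 // sumr_ge0.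
Qed.

(* The weights make the window sum telescope. *)
Lemma weighted_window (f : nat -> R) t m :
  \sum_(j < m) j.+1%:R * f (t.+1 + j)%N =
  \sum_(j < m) j.+1%:R * f (t + j)%N + m%:R * f (t + m)%N
    - \sum_(j < m) f (t + j)%N.
Proof.
elim: m => [|m IH]; first by rewrite !big_ord0 mul0r addr0 subr0.
rewrite !big_ord_recr /= IH addSnnS -(natr1 m); ring.
Qed.

End Sequences.

(** Once some update [t0] has occurred, the last update up to [t] and the next one are consecutive,
    so at most [Ta] apart; the summand [t0] in the witness covers the times before [t0]. *)
Lemma hitting_window (T : set nat) (Ta : nat) : infinite_set T ->
  (forall s t, consecutive_in T s t -> (t - s <= Ta)%N) ->
  exists M, forall t, exists2 r, T r & (t < r <= t + M)%N.
Proof.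
move=> Tinf gap.
have later t : exists r, `[< T r >] && (t < r)%N.
  apply: contrapT => no; apply: Tinf.
  apply: sub_finite_set (finite_II t.+1) => r Tr /=.
  rewrite ltnS leqNgt; apply/negP => tr; apply: no; exists r.
  by rewrite tr andbT; apply/asboolP.
have [t0 /andP[/asboolP Tt0 _]] := later 0%N.
exists (t0 + Ta)%N => t.
case: (ex_minnP (later t)) => r /andP[/asboolP Tr tr] rmin.
exists r; rewrite // tr /=.
have [t0t|tt0] := leqP t0 t; last first.
  have : (r <= t0)%N by apply: rmin; rewrite tt0 andbT; apply/asboolP.
  by lia.
have ex_s : exists s, `[< T s >] && (s <= t)%N.
  by exists t0; rewrite t0t andbT; apply/asboolP.
have bnd s : `[< T s >] && (s <= t)%N -> (s <= t)%N by case/andP.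
case: (ex_maxnP ex_s bnd) => s /andP[/asboolP Ts st] smax.
have : (r - s <= Ta)%N.
  apply: gap; split=> //; first by lia.
  move=> k Tk; apply/negP => /andP[sk kr].
  have [kt|tk] := leqP k t.
    have : (k <= s)%N by apply: smax; rewrite kt andbT; apply/asboolP.
    by lia.
  have : (r <= k)%N by apply: rmin; rewrite tk andbT; apply/asboolP.
  by lia.
lia.
Qed.

(** * Properties of the voltage violation *)

Section Deadband.
Variables (R : realType) (n : nat) (vlow vbar : 'cV[R]_n).
Hypothesis vlow_le : forall i, vlow i ord0 <= vbar i ord0.

(** With [p] the projection of [a] onto the interval, [dcoord] is [a - p], and
    [(a - p) * (p - w) >= 0]. *)
Lemma dcoord_inward i a w : vlow i ord0 <= w <= vbar i ord0 ->
  dcoord vlow vbar i a ^+ 2 <= dcoord vlow vbar i a * (a - w).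
Proof.
move=> /andP[lw wb]; rewrite /dcoord /pos_part.
by case: (leP (a - _)); case: (leP (_ - a)) => *; nra.
Qed.

(** Since [vlow <= vbar], the two positive parts are never active together, so only slopes 0 and 1
    occur. *)
Lemma dcoord_lipschitz i a b :
  `|dcoord vlow vbar i a - dcoord vlow vbar i b| <= `|a - b|.
Proof.
have lei := vlow_le i; have abN := ler_norm (a - b).
have baN := ler_norm (b - a); rewrite (distrC b) in baN.
rewrite ler_norml /dcoord /pos_part.
case: (leP (a - _)); case: (leP (_ - a)); case: (leP (b - _));
  case: (leP (_ - b)) => *; apply/andP; split; lra.
Qed.

Lemma dcoord_eq0 i a : dcoord vlow vbar i a = 0 ->
  vlow i ord0 <= a <= vbar i ord0.
Proof.
have := vlow_le i; rewrite /dcoord /pos_part.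
by case: (leP (a - _)); case: (leP (_ - a)) => *; apply/andP; split; lra.
Qed.

(** At a bus with a one-point interval, convergence of the violation thus gives convergence of the
    voltage. *)
Lemma dcoord_degenerate i a : vlow i ord0 = vbar i ord0 ->
  dcoord vlow vbar i a = a - vbar i ord0.
Proof.
rewrite /dcoord /pos_part => ->.
by case: (leP (a - _)); case: (leP (_ - a)) => *; lra.
Qed.

End Deadband.

(** * Energy descent under delays, and convergence *)

Section Dynamics.
Variables (R : realType) (n : nat) (X : 'M[R]_n).
Variables (vlow vbar vpar : 'cV[R]_n) (eps sigma : R).
Variables (T : 'I_n -> set nat) (tau : 'I_n -> nat -> nat) (Ta Td : nat).
Variables (q : nat -> 'cV[R]_n) (v : int -> 'cV[R]_n).
Hypothesis X_psd : psd X.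
Hypothesis X_definite : forall u, dotc u (X *m u) = 0 -> u = 0.
Hypothesis X_sigma : forall u, dotc u (X *m u) <= sigma * dotc u u.
Hypothesis vlow_le : forall i, vlow i ord0 <= vbar i ord0.
Hypothesis T_inf : forall i, infinite_set (T i).
Hypothesis T_gap : forall i s t, consecutive_in (T i) s t -> (t - s <= Ta)%N.
Hypothesis tau_le : forall i t, (tau i t <= Td)%N.
Hypothesis dyn : voltage_dynamics X vpar q v.
Hypothesis alg : async_update eps vlow vbar T tau q v.
Hypothesis eps_gt0 : 0 < eps.
Hypothesis eps_lt : eps * (sigma + 2 * frobenius X * Td%:R) < 2.

Local Notation F := (frobenius X).
Local Notation d := (dcoord vlow vbar).
Local Notation volt u := (X *m u + vpar).
Local Notation "u ~~> l" := (u @ \oo --> (l : R)) (at level 70).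

Let step t := q t.+1 - q t.
Let energy (c : 'cV[R]_n) t := dotc (q t - c) (X *m (q t - c)).

Lemma X_unit : X \in unitmx.
Proof.
apply: unitmx_inj => u Xu; apply: X_definite.
by rewrite Xu /dotc big1 // => i _; rewrite mxE mulr0.
Qed.

Lemma volt_step t i :
  volt (q t.+1) i ord0 - volt (q t) i ord0 = (X *m step t) i ord0.
Proof. by rewrite mulmxBr !mxE; ring. Qed.

(** [Td <= r] keeps the measurement time [r.+1 - tau] positive, out of the arbitrary history; the
    voltage read there comes from [q (r - tau)]. *)
Lemma step_update r i : (Td <= r)%N -> T i r.+1 ->
  step r i ord0 = - eps * d i (volt (q (r - tau i r.+1)) i ord0).
Proof.
move=> Tdr Ti; have [_ /(_ Ti)] := alg i (ltn0Sn r); rewrite !mxE => ->.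
have -> : r.+1%:Z - (tau i r.+1)%:Z = (r - tau i r.+1).+1%:Z.
  by rewrite subzn ?subSn // (leq_trans (tau_le _ _)) // ltnW.
by rewrite dyn !mxE /=; ring.
Qed.

Lemma step_idle r i : ~ T i r.+1 -> step r i ord0 = 0.
Proof.
by move=> nTi; have [/(_ nTi)] := alg i (ltn0Sn r); rewrite !mxE => -> _; ring.
Qed.

Lemma volt_window t i a b L :
  (t <= a <= t + L)%N -> (t <= b <= t + L)%N ->
  `|volt (q a) i ord0 - volt (q b) i ord0| <=
  \sum_(k < L) `|(X *m step (t + k)) i ord0|.
Proof.
move=> aL bL.
have := window_dist (fun s => volt (q s) i ord0) aL bL.
by under eq_bigr do rewrite volt_step.
Qed.

(** Split the current voltage into the measured value and the lag. The measured value gives the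
    negative square by [dcoord_inward], and the window sum bounds the lag; at an idle bus both sides
    are 0. *)
Lemma step_descent t i w : vlow i ord0 <= w <= vbar i ord0 ->
  step (t + Td) i ord0 * (volt (q (t + Td)) i ord0 - w) <=
  - step (t + Td) i ord0 ^+ 2 / eps +
  \sum_(k < Td) `|step (t + Td) i ord0| * `|(X *m step (t + k)) i ord0|.
Proof.
move=> w_box; set r := (t + Td)%N; set s := step r i ord0.
rewrite -mulr_sumr; set S := \sum_(k < Td) _.
have [Ti|/step_idle s0] := pselect (T i r.+1); last first.
  by rewrite /s s0 normr0 expr2 !mul0r oppr0 mul0r addr0.
have sE : s = - eps * d i _ := step_update (leq_addl _ _) Ti.
set m := (r - tau i r.+1)%N in sE; set a := volt (q m) i ord0 in sE.
have tau_r := tau_le i r.+1.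
have lag : `|volt (q r) i ord0 - a| <= S.
  by apply: volt_window; move: tau_r; rewrite /m /r; lia.
have inward := @dcoord_inward _ _ vlow vbar i a w w_box.
have -> : volt (q r) i ord0 - w = (a - w) + (volt (q r) i ord0 - a) by ring.
rewrite mulrDr; apply: lerD.
  rewrite sE; have -> : - (- eps * d i a) ^+ 2 / eps = - eps * d i a ^+ 2.
    by field; rewrite gt_eqF.
  by rewrite -mulrA !mulNr lerN2 ler_pM2l.
apply: le_trans (ler_norm _) _; rewrite normrM ler_wpM2l //.
Qed.

Let gap2 t := dotc (step t) (step t).

(** The cross term sums [step_descent] over the buses, and [sigma] bounds the quadratic one. In each
    lag product [sum_norm_mulmx_le] charges half to the current step, [Td] times in all, and half to
    a past step. *)
Lemma energy_step c t : box vlow vbar (volt c) ->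
  energy c (t + Td).+1 <= energy c (t + Td)
    - (2 / eps - sigma - F * Td%:R) * gap2 (t + Td)
    + F * \sum_(k < Td) gap2 (t + k).
Proof.
move=> c_box; set r := (t + Td)%N; set s := step r.
have [Xsym _] := X_psd.
have -> : energy c r.+1 =
    energy c r + 2 * dotc s (X *m (q r - c)) + dotc s (X *m s).
  rewrite /energy; have -> : q r.+1 - c = (q r - c) + s.
    by rewrite /s /step; apply/matrixP => i j; rewrite !mxE; ring.
  move: (q r - c) => z; clearbody s.
  rewrite mulmxDr !dotcE (dotc_mulmx X z s) Xsym (dotcC (X *m _) s).
  by ring.
have cross : dotc s (X *m (q r - c)) <= - gap2 r / eps
    + (F * Td%:R / 2 * gap2 r + F / 2 * \sum_(k < Td) gap2 (t + k)).
  have -> : dotc s (X *m (q r - c)) =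
      \sum_i s i ord0 * (volt (q r) i ord0 - volt c i ord0).
    by apply: eq_bigr => i _; rewrite mulmxBr !mxE; ring.
  apply: le_trans; first by apply: ler_sum => i _; exact: step_descent (c_box i).
  rewrite big_split /= -mulr_suml sumrN; apply: lerD.
    by rewrite /gap2 /dotc; under eq_bigr do rewrite expr2.
  rewrite exchange_big /=.
  apply: le_trans; first by apply: ler_sum => k _; exact: sum_norm_mulmx_le.
  rewrite -mulr_suml -mulr_sumr big_split /= sumr_const card_ord -/(gap2 r).
  by rewrite -[_ *+ Td]mulr_natr le_eqVlt; apply/orP; left; apply/eqP; field.
have := X_sigma s; rewrite -/(gap2 r); move: cross.
set G := \sum_(k < Td) _; move=> cross quad.
have -> : (2 / eps - sigma - F * Td%:R) * gap2 r =
  - (2 * (- gap2 r / eps)) - sigma * gap2 r - F * Td%:R * gap2 r by ring.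
by lra.
Qed.

(** A squared step enters the window with weight [Td] and loses one unit per time step, which pays
    for the past steps in [energy_step]. *)
Let lyapunov c t :=
  energy c (t + Td) + F * \sum_(j < Td) j.+1%:R * gap2 (t + j).

(** The entering weight costs another [F * Td]; the step size bound says exactly that the remainder
    is positive. *)
Let rate := 2 / eps - sigma - 2 * F * Td%:R.

Lemma rate_gt0 : 0 < rate.
Proof.
have -> : rate = (2 - eps * (sigma + 2 * F * Td%:R)) / eps.
  by rewrite /rate; field; rewrite gt_eqF.
by rewrite divr_gt0 // subr_gt0.
Qed.

Lemma lyapunov_step c t : box vlow vbar (volt c) ->
  lyapunov c t.+1 <= lyapunov c t - rate * gap2 (t + Td).
Proof.
move=> /(energy_step t); rewrite /lyapunov weighted_window addSn /rate.
set S := \sum_(k < Td) _; set S' := \sum_(j < Td) _.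
set g := gap2 _; move=> H; apply: le_trans (lerD H (lexx _)) _.
by rewrite le_eqVlt; apply/orP; left; apply/eqP; ring.
Qed.

Lemma lyapunov_cvg c : box vlow vbar (volt c) -> exists l, lyapunov c ~~> l.
Proof.
move=> c_box; have [_ X_ge0] := X_psd.
exists (inf (range (lyapunov c))); apply: nonincreasing_cvgn.
  apply/nonincreasing_seqP => t; apply: le_trans (lyapunov_step t c_box) _.
  by rewrite gerBl mulr_ge0 ?dotc_ge0 // ltW // rate_gt0.
exists 0 => _ [t _ <-]; rewrite addr_ge0 ?X_ge0 // mulr_ge0 ?frobenius_ge0 //.
by apply: sumr_ge0 => j _; rewrite mulr_ge0 ?dotc_ge0.
Qed.

(** Any voltage profile is realised by some injection, so reference points can be prescribed by
    their voltages. *)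
Let center (w : 'cV[R]_n) := invmx X *m (w - vpar).

Lemma volt_center w : volt (center w) = w.
Proof. by rewrite mulKVmx ?X_unit // subrK. Qed.

Lemma gap2_cvg0 : gap2 ~~> 0.
Proof.
have c_box : box vlow vbar (volt (center vlow)).
  by rewrite volt_center => i; rewrite lexx vlow_le.
have [l Wl] := lyapunov_cvg c_box; set W := lyapunov _ in Wl.
rewrite -(cvg_shiftn Td gap2).
apply: (@squeeze_cvgr _ _ _ _ (fun=> 0) (fun t => (W t - W t.+1) * rate^-1)).
- apply: nearW => t; rewrite dotc_ge0 /= ler_pdivlMr ?rate_gt0 //.
  by have := lyapunov_step t c_box; rewrite -/W; lra.
- exact: cvg_cst.
- rewrite -[X in _ --> X](mul0r rate^-1); apply: cvgM; last exact: cvg_cst.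
  by rewrite -[X in _ --> X](subrr l); apply: cvgB => //; rewrite cvg_shiftS.
Qed.

Lemma energy_cvg c : box vlow vbar (volt c) -> exists l, energy c ~~> l.
Proof.
move=> c_box; have [l Wl] := lyapunov_cvg c_box; exists (l - F * 0).
rewrite -(cvg_shiftn Td (energy c)).
have -> : (fun t => energy c (t + Td)%N) = (fun t => lyapunov c t -
    F * \sum_(j < Td) j.+1%:R * gap2 (t + j)).
  by apply/funext => t; rewrite /lyapunov addrK.
apply: cvgB => //; apply: cvgM; first exact: cvg_cst.
exact: (@cvg_window0 _ gap2 (fun j => j.+1%:R) Td gap2_cvg0).
Qed.

Lemma step_cvg0 i : (fun t => step t i ord0) ~~> 0.
Proof.
apply: cvg0_sqr_le gap2_cvg0 => t.
rewrite /gap2 /dotc (bigD1 i) //= -expr2 lerDl.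
by apply: sumr_ge0 => j _; rewrite -expr2 sqr_ge0.
Qed.

Lemma Xstep_cvg0 i : (fun t => (X *m step t) i ord0) ~~> 0.
Proof.
have := @cvg_mulmx_coord _ _ _ X step 0 i; rewrite mulmx0 mxE; apply.
by move=> j; rewrite mxE; exact: step_cvg0.
Qed.

(** At the next update of bus [i], [d] of the measured voltage is a vanishing step divided by
    [- eps]; from that measurement to the present the voltage drifts by boundedly many vanishing
    terms, and [d] is Lipschitz. *)
Lemma d_cvg0 i : (fun t => d i (volt (q t) i ord0)) ~~> 0.
Proof.
have [M hitM] := hitting_window (@T_inf i) (@T_gap i).
rewrite -(cvg_shiftn Td (fun t => d i (volt (q t) i ord0))).
(* The update falls within [M] after [t + Td] and reads a voltage at most [Td] older, so all indices
   of [q] lie between [t] and [t + L]. *)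
pose L := (Td + M)%N.
pose bnd t := \sum_(k < L) eps^-1 * `|step (t + k) i ord0| +
  \sum_(k < L) 1 * `|(X *m step (t + k)) i ord0|.
have norm0 (f : nat -> R) : f ~~> 0 -> (fun t => `|f t|) ~~> 0.
  by move=> f0; rewrite -(normr0 R); exact: cvg_norm f0.
have bnd0 : bnd ~~> 0.
  rewrite -[X in _ --> X]addr0; apply: cvgD.
    exact: (@cvg_window0 _ _ (fun=> eps^-1) L (norm0 _ (step_cvg0 i))).
  exact: (@cvg_window0 _ _ (fun=> 1) L (norm0 _ (Xstep_cvg0 i))).
apply: norm_cvg0; apply: (squeeze_cvgr _ (cvg_cst 0) bnd0).
apply: nearW => t; rewrite normr_ge0 /=.
have [[//|r] Tr /andP[tr rM]] := hitM (t + Td)%N.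
have := tau_le i r.+1 => tau_r.
have sE := step_update (leq_trans (leq_addl t Td) tr) Tr.
set a := volt (q (r - _)) i ord0 in sE.
have -> : d i (volt (q (t + Td)) i ord0) =
  d i a + (d i (volt (q (t + Td)) i ord0) - d i a) by ring.
apply: le_trans (ler_normD _ _) _; apply: lerD.
  have -> : d i a = - (eps^-1 * step r i ord0).
    by rewrite sE; field; rewrite gt_eqF.
  rewrite normrN normrM gtr0_norm ?invr_gt0 //.
  have rL : (r - t < L)%N by rewrite /L; lia.
  rewrite (bigD1 (Ordinal rL)) //= subnKC; last by lia.
  by rewrite lerDl sumr_ge0 // => k _; rewrite mulr_ge0 // invr_ge0 ltW.
apply: le_trans (dcoord_lipschitz vlow_le _ _ _) _.
under eq_bigr do rewrite mul1r.
by apply: volt_window; rewrite /L; lia.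
Qed.

(* Moving the reference point by [h] with [X h = delta e_i] changes the energy
   by an affine function of [q_i], so convergence of both energies yields that
   of [q_i]. *)
Lemma q_cvg_free i : vlow i ord0 < vbar i ord0 ->
  exists l, (fun t => q t i ord0) ~~> l.
Proof.
move=> vi; have [Xsym _] := X_psd.
pose delta := vbar i ord0 - vlow i ord0.
have delta_gt0 : 0 < delta by rewrite subr_gt0.
pose c := center vlow; pose h : 'cV[R]_n := invmx X *m (delta *: delta_mx i ord0).
have Xh : X *m h = delta *: delta_mx i ord0 by rewrite mulKVmx ?X_unit.
have c_box : box vlow vbar (volt c).
  by rewrite volt_center => j; rewrite lexx vlow_le.
have ch_box : box vlow vbar (volt (c + h)).
  rewrite mulmxDr addrAC volt_center Xh => j; rewrite !mxE eqxx andbT.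
  case: eqVneq => [->|_]; rewrite ?mulr1 ?mulr0 ?addr0 ?lexx ?vlow_le //.
  by rewrite lerDl ltW //= /delta; lra.
have [l cl] := energy_cvg c_box; have [l' chl] := energy_cvg ch_box.
(* With [z = q t - c], the energies differ by [2 * delta * z_i - delta * h_i]; solving for [q_i]
   gives this limit. *)
exists ((l - l' + delta * h i ord0) * (2 * delta)^-1 + c i ord0).
have -> : (fun t => q t i ord0) = (fun t =>
    (energy c t - energy (c + h) t + delta * h i ord0) * (2 * delta)^-1
    + c i ord0).
  apply/funext => t; rewrite /energy.
  have -> : q t - (c + h) = (q t - c) - h by rewrite opprD addrA.
  have -> : q t i ord0 = (q t - c) i ord0 + c i ord0 by rewrite !mxE subrK.
  congr (_ + _); move: (q t - c) => z; rewrite mulmxBr !dotcE.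
  rewrite (dotc_mulmx X h z) Xsym !Xh !dotcE [dotc (delta_mx _ _) z]dotcC.
  rewrite !dotc_delta; field; rewrite gt_eqF //.
apply: cvgD; last exact: cvg_cst.
apply: cvgM; last exact: cvg_cst.
by apply: cvgD; [exact: cvgB|exact: cvg_cst].
Qed.

(* For each [i], either [q_i] or [v_i] converges. The matrix whose i-th row
   selects the one that does is invertible, because [z_i (X z)_i = 0] for all
   [i] forces [z . X z = 0]. *)
Lemma q_cvg : exists l : 'cV[R]_n, forall i, (fun t => q t i ord0) ~~> l i ord0.
Proof.
pose A : 'M[R]_n := \matrix_(i, j)
  if vlow i ord0 == vbar i ord0 then X i j else (1%:M : 'M[R]_n) i j.
have rowA (z : 'cV[R]_n) i : (A *m z) i ord0 =
    if vlow i ord0 == vbar i ord0 then (X *m z) i ord0 else z i ord0.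
  rewrite -[z in RHS]mul1mx !mxE.
  by case: ifP => vi; apply: eq_bigr => j _; rewrite mxE vi ?mul1mx.
have unitA : A \in unitmx.
  apply: unitmx_inj => z Az; apply: X_definite; apply: big1 => i _.
  have := rowA z i; rewrite Az mxE.
  by case: ifP => _ <-; rewrite ?mul0r ?mulr0.
have Acvg i : exists l, (fun t => (A *m q t) i ord0) ~~> l.
  rewrite (_ : (fun t => _) = (fun t => if vlow i ord0 == vbar i ord0
    then (X *m q t) i ord0 else q t i ord0)); last exact/funext.
  case: eqVneq => [vi|vi]; last by apply: q_cvg_free; rewrite lt_neqAle vi vlow_le.
  exists (0 + (vbar i ord0 - vpar i ord0)).
  have -> : (fun t => (X *m q t) i ord0) = (fun t =>
      d i (volt (q t) i ord0) + (vbar i ord0 - vpar i ord0)).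
    by apply/funext => t; rewrite dcoord_degenerate // !mxE; ring.
  by apply: cvgD; [exact: d_cvg0|exact: cvg_cst].
have [b Ab] := choice Acvg.
exists (invmx A *m (\col_i b i)) => i.
have -> : (fun t => q t i ord0) = (fun t => (invmx A *m (A *m q t)) i ord0).
  by apply/funext => t; rewrite mulKmx.
by apply: cvg_mulmx_coord => j; rewrite mxE; exact: Ab.
Qed.

Lemma d_seq_cvg : (fun t : nat => dvec vlow vbar (v t%:Z)) @ \oo --> (0 : 'cV[R]_n).
Proof.
(* Shifting by one drops [v 0], which belongs to the arbitrary history. *)
rewrite -cvg_shiftS; apply: cvg_coord => i j; rewrite ord1 [X in _ --> X]mxE.
by under eq_fun do rewrite mxE dyn; exact: d_cvg0.
Qed.

Lemma v_cvg : exists2 vstar : 'cV[R]_n, box vlow vbar vstar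
  & (fun t : nat => v t%:Z) @ \oo --> vstar.
Proof.
have [l ql] := q_cvg.
have vl i : (fun t => volt (q t) i ord0) ~~> volt l i ord0.
  rewrite [X in _ --> X]mxE; under eq_fun do rewrite mxE.
  by apply: cvgD; [exact: cvg_mulmx_coord|exact: cvg_cst].
exists (volt l).
  (* By continuity [d] of the limit is the limit of [d], which is 0. *)
  move=> i; apply: dcoord_eq0 => //.
  have dl : (fun t => d i (volt (q t) i ord0)) ~~> d i (volt l i ord0).
    apply: (@cvg_sub0 _ _ _ _ _ _ (fun=> d i (volt l i ord0))); last exact: cvg_cst.
    apply: norm_cvg0.
    apply: (@squeeze_cvgr _ _ _ _ (fun=> 0)
      (fun t => `|volt (q t) i ord0 - volt l i ord0|)).
    - apply: nearW => t; rewrite normr_ge0 /=.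
      exact: dcoord_lipschitz.
    - exact: cvg_cst.
    - rewrite -(normr0 R); apply: cvg_norm.
      rewrite -[X in _ --> X](subrr (volt l i ord0)).
      by apply: cvgB; [exact: vl|exact: cvg_cst].
  exact: cvg_unique dl (@d_cvg0 i).
rewrite -cvg_shiftS; apply: cvg_coord => i j; rewrite ord1.
by under eq_fun do rewrite /= dyn; exact: vl.
Qed.

End Dynamics.

(** * Application to the reactance matrix of the tree *)

Theorem theorem3 (R : realType) (n : nat)
    (E : {set {set 'I_n.+1}}) (x : {set 'I_n.+1} -> R)
    (vlow vbar vpar : 'cV[R]_n) (eps : R)
    (T : 'I_n -> set nat) (tau : 'I_n -> nat -> nat) (Ta Td : nat)
    (q : nat -> 'cV[R]_n) (v : int -> 'cV[R]_n)
    (treeE : is_tree E)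
    (x_gt0 : forall l, l \in E -> 0 < x l)
    (vlow_le : forall i, vlow i ord0 <= vbar i ord0)
    (T_gt0 : forall i t, T i t -> (0 < t)%N)
    (T_inf : forall i, infinite_set (T i))
    (T_gap : forall i s t, consecutive_in (T i) s t -> (t - s <= Ta)%N)
    (tau_le : forall i t, (tau i t <= Td)%N)
    (dyn : voltage_dynamics (Xmat E x) vpar q v)
    (alg : async_update eps vlow vbar T tau q v)
    (eps_gt0 : 0 < eps)
    (eps_lt : eps < 2 / (sigma_max (Xmat E x)
                         + 2 * frobenius (Xmat E x) * Td%:R)) :
  ((fun t : nat => dvec vlow vbar (v t%:Z)) @ \oo --> (0 : 'cV[R]_n)) /\
  (exists2 vstar : 'cV[R]_n, box vlow vbar vstar
     & (fun t : nat => v t%:Z) @ \oo --> vstar).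
Proof.
set X := Xmat E x in dyn eps_lt.
have X_psd : psd X := Xmat_psd x_gt0.
have X_definite := Xmat_definite treeE x_gt0.
have X_sigma u := dotc_le_sigma_max u X_psd.
have eps_lt2 : eps * (sigma_max X + 2 * frobenius X * Td%:R) < 2.
  have : 0 <= sigma_max X + 2 * frobenius X * Td%:R.
    by rewrite addr_ge0 ?sigma_max_ge0 // !mulr_ge0 ?frobenius_ge0.
  rewrite le_eqVlt => /predU1P[D0|D_gt0]; last by rewrite -ltr_pdivlMr.
  (* If the denominator vanished, the quotient would be 0 by convention and [eps] negative. *)
  by move: eps_lt; rewrite -D0 invr0 mulr0 ltNge ltW.
split.
  exact: (d_seq_cvg X_psd X_definite X_sigma vlow_le T_inf T_gap tau_le dyn alg
    eps_gt0 eps_lt2).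
exact: (v_cvg X_psd X_definite X_sigma vlow_le T_inf T_gap tau_le dyn alg
  eps_gt0 eps_lt2).
Qed.
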